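(* Let $\delta$ be a homogeneous first order differential operator with constant coefficients, $\delta=\sum_{i=1}^n\beta_iD_i$ with $\beta_i\in\mathbb{C}$, and let $\Lambda=\delta^k$ for some $k\ge1$. Then: (a) A polynomial $P(z)\in\mathbb{C}[z_1,\dots,z_n]$ is $\Lambda$-nilpotent if (and only if) $\Lambda P=0$. (b) $\mathbf{VC}$ holds for $\Lambda$; that is, for every $\Lambda$-nilpotent polynomial $P(z)\in\mathbb{C}[z_1,\dots,z_n]$, one has $\Lambda^m(P^{m+1})=0$ for all sufficiently large $m$.
   Context: $D_i=\partial/\partial z_i$. A polynomial $P$ is $\Lambda$-nilpotent if $\Lambda^m(P^m)=0$ for all $m\ge1$. *)

(* Defs.v *)
From HB Require Import structures.
From mathcomp Require Import all_boot all_order all_algebra.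
From mathcomp Require Import reals.
From mathcomp Require Import complex mpoly.

Set Implicit Arguments.
Unset Strict Implicit.
Unset Printing Implicit Defensive.

Import GRing.Theory.

Local Open Scope ring_scope.

Definition delta (R : realType) (n : nat) (beta : 'I_n -> R[i])
    (P : {mpoly R[i][n]}) : {mpoly R[i][n]} :=
  \sum_(i < n) beta i *: P^`M(i).

Definition nilpotent_for (R : realType) (n : nat)
    (Lambda : {mpoly R[i][n]} -> {mpoly R[i][n]})
    (P : {mpoly R[i][n]}) : Prop :=
  forall m : nat, (1 <= m)%N -> iter m Lambda (P ^+ m) = 0.

Definition VC (R : realType) (n : nat)
    (Lambda : {mpoly R[i][n]} -> {mpoly R[i][n]}) : Prop :=
  forall P : {mpoly R[i][n]}, nilpotent_for Lambda P ->
    exists N : nat, forall m : nat, (N <= m)%N ->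
      iter m Lambda (P ^+ m.+1) = 0.

(* Main.v *)
Require Import Defs.
From HB Require Import structures.
From mathcomp Require Import all_boot all_order all_algebra.
From mathcomp Require Import reals.
From mathcomp Require Import complex mpoly.
From mathcomp Require Import zify.

(** Write [deg P < a] for the condition [delta^a P = 0].  By the Leibniz rule the
    degree of a product is at most the sum of the degrees, so [deg P <= k - 1]
    gives [deg P^m <= m (k - 1)].  This is less than [m k] for [m >= 1], and
    [deg P^(m+1) <= (m + 1) (k - 1) < m k] as soon as [m >= k]. *)

Set Implicit Arguments.
Unset Strict Implicit.
Unset Printing Implicit Defensive.

Import GRing.Theory.

Local Open Scope ring_scope.

Lemma iter_additive (A : zmodType) (d : {additive A -> A}) j :
  {morph iter j d : x y / x + y}.
Proof. by elim: j => // j IHj x y; rewrite !iterS IHj raddfD. Qed.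

Lemma iter_eq0_leq (A : zmodType) (d : {additive A -> A}) i j x :
  (i <= j)%N -> iter i d x = 0 -> iter j d x = 0.
Proof.
move=> /subnK <- dix; rewrite iterD dix.
by apply: iter_fix; rewrite raddf0.
Qed.

Section Derivation.

Variables (A : pzRingType) (d : {additive A -> A}).
Hypothesis dM : forall x y, d (x * y) = d x * y + x * d y.

(** Induction on [a + b]: one application of [d] splits [x * y] into two terms, each with one of the
    two exponents lowered by one. *)
Lemma iter_derivation_mul_eq0 a b x y :
  iter a d x = 0 -> iter b d y = 0 -> iter (a + b).-1 d (x * y) = 0.
Proof.
have iter0 j : iter j d 0 = 0 by apply: iter_fix; rewrite raddf0.
have [s] := ubnP (a + b)%N.
elim: s a b x y => // s IHs [|a] [|b] x y lt_s dx dy.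
(* A zero exponent says that the factor itself is 0, so the truncation of [.-1] at [a = b = 0] is
   harmless. *)
- by rewrite [x]dx mul0r iter0.
- by rewrite [x]dx mul0r iter0.
- by rewrite [y]dy mulr0 iter0.
have IHx := IHs a b.+1 (d x) y; rewrite -iterSr addnS in IHx.
have IHy := IHs a.+1 b x (d y); rewrite -iterSr addSn in IHy.
rewrite addnS addSn iterSr dM iter_additive.
by rewrite IHx ?IHy ?addr0 //; lia.
Qed.

Lemma iter_derivation_exp_eq0 k m x :
  iter k.+1 d x = 0 -> iter (m * k).+1 d (x ^+ m) = 0.
Proof.
move=> dx; elim: m => [|m IHm].
  (* For [m = 0] the claim is [d 1 = 0]: cancel [d 1] in [d (1 * 1) = d 1 + d 1]. *)
  by apply: (@addrI _ (d 1)); rewrite addr0 -[in RHS](mulr1 1) dM mulr1 mul1r.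
by have := iter_derivation_mul_eq0 dx IHm; rewrite -exprS addnS addSn.
Qed.

End Derivation.

Section Delta.

Variables (R : realType) (n : nat) (beta : 'I_n -> R[i]).

Fact delta_is_additive : zmod_morphism (delta beta).
Proof.
move=> P Q; rewrite /delta -sumrB.
by apply: eq_bigr => i _; rewrite raddfB scalerBr.
Qed.

HB.instance Definition _ :=
  GRing.isZmodMorphism.Build _ _ (delta beta) delta_is_additive.

Lemma deltaM P Q : delta beta (P * Q) = delta beta P * Q + P * delta beta Q.
Proof.
rewrite /delta mulr_suml mulr_sumr -big_split; apply: eq_bigr => i _ /=.
by rewrite mderivM scalerDr scalerAl scalerAr.
Qed.

(** The left side is [delta^(j * k.+1)] applied to [P ^+ m], whose degree is at most [m * k]. *)
Lemma iter_iter_delta_exp_eq0 k j m P :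
  (m * k < j * k.+1)%N -> iter k.+1 (delta beta) P = 0 ->
  iter j (iter k.+1 (delta beta)) (P ^+ m) = 0.
Proof.
move=> lt_mj dP; rewrite -iterM.
exact: iter_eq0_leq lt_mj (iter_derivation_exp_eq0 deltaM _ dP).
Qed.

End Delta.

Theorem proposition3p18 (R : realType) (n : nat) (beta : 'I_n -> R[i])
    (k : nat) (hk : (1 <= k)%N) :
  let Lambda : {mpoly R[i][n]} -> {mpoly R[i][n]} := iter k (delta beta) in
  (forall P : {mpoly R[i][n]}, nilpotent_for Lambda P <-> Lambda P = 0) /\
  VC Lambda.
Proof.
case: k hk => // k _ Lambda; split=> [P|P nilP].
  split=> [/(_ 1%N isT) //|dP m m_gt0].
  by apply: iter_iter_delta_exp_eq0 => //; nia.
(* Now [Lambda] is [delta^(k.+1)], and [m.+1 * k < m * k.+1] amounts to [k < m]. *)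
exists k.+1 => m le_km.
by apply: iter_iter_delta_exp_eq0; [nia | exact: (nilP 1%N)].
Qed.
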